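(* Let $R$ be a commutative ring. The natural map $Br^*(R) \to Br(R)$ is an isomorphism if and only if endomorphism rings of faithful finitely generated projective $R$-modules are stably matrix algebras. If all faithful finitely generated projective $R$-modules are free, or even stably tensor free, then all their endomorphism rings are stably matrix algebras.
   Context: If $N\subseteq M$ is a submonoid of a commutative monoid, $M/N$ is the monoid of equivalence classes of $M$ under: $m_1\sim m_2$ iff there are $n_1,n_2\in N$ with $m_1n_1=m_2n_2$. $MA(R)$ is the monoid of isomorphism classes of Azumaya $R$-algebras with operation induced by $\otimes_R$; $ME(R)\subseteq MA(R)$ is the submonoid of classes of endomorphism rings of faithful finitely generated projective $R$-modules; $MM(R)\subseteq MA(R)$ is the submonoid of classes of matrix algebras $M_n(R)$, $n\ge1$. $Br^*(R)=MA(R)/MM(R)$ and $Br(R)=MA(R)/ME(R)$ (the Brauer group); the map $Br^*(R)\to Br(R)$ sends the class of $A$ to the class of $A$. An $R$-algebra $A$ is a stably matrix algebra if there are $n,m\ge1$ such that $A\otimes_R M_n(R)\cong M_m(R)$ as $R$-algebras. A faithful finitely generated projective $R$-module $P$ is stably tensor free if there are $n,m\ge 1$ such that $P\otimes_R R^n\cong R^m$. *)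

(* Defs.v *)
From HB Require Import structures.
From mathcomp Require Import all_boot all_algebra.
From mathcomp Require Import boolp.

Set Implicit Arguments.
Unset Strict Implicit.
Unset Printing Implicit Defensive.

Import GRing.Theory.
Local Open Scope ring_scope.
Local Open Scope quotient_scope.

(* Rings and algebras are allowed to be trivial: MathComp's algType requires
   1 != 0, whereas End_R(P) or a tensor product of algebras may vanish. *)

Definition hom (R : comPzRingType) (M N : lmodType R) := {linear M -> N}.

Section Hom.
Variables (R : comPzRingType) (M N : lmodType R).

Definition mkhom (f : M -> N) (lin_f : linear f) : hom M N :=
  HB.pack f (GRing.isLinear.Build R M N *:%R f lin_f).

Lemma hom_ext (f g : hom M N) : f =1 g -> f = g.
Proof.
case: f g => f [[f0] [f1]] [g [[g0] [g1]]] /= eq_fg.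
have {}eq_fg : f = g by apply: funext.
by subst g; rewrite (Prop_irrelevance f0 g0) (Prop_irrelevance f1 g1).
Qed.

HB.instance Definition _ := gen_eqMixin (hom M N).
HB.instance Definition _ := gen_choiceMixin (hom M N).

Fact hom0_lin : linear (fun _ : M => 0 : N).
Proof. by move=> a u v; rewrite scaler0 addr0. Qed.
Fact homD_lin (f g : hom M N) : linear (fun x => f x + g x).
Proof. by move=> a u v; rewrite !linearP scalerDr addrACA. Qed.
Fact homN_lin (f : hom M N) : linear (fun x => - f x).
Proof. by move=> a u v; rewrite linearP opprD scalerN. Qed.
Fact homZ_lin (r : R) (f : hom M N) : linear (fun x => r *: f x).
Proof. by move=> a u v; rewrite linearP scalerDr !scalerA mulrC. Qed.

Fact hom_addA : associative (fun f g => mkhom (homD_lin f g)).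
Proof. by move=> f g h; apply: hom_ext => x /=; rewrite addrA. Qed.
Fact hom_addC : commutative (fun f g => mkhom (homD_lin f g)).
Proof. by move=> f g; apply: hom_ext => x /=; rewrite addrC. Qed.
Fact hom_add0 : left_id (mkhom hom0_lin) (fun f g => mkhom (homD_lin f g)).
Proof. by move=> f; apply: hom_ext => x /=; rewrite add0r. Qed.
Fact hom_addN : left_inverse (mkhom hom0_lin) (fun f => mkhom (homN_lin f))
  (fun f g => mkhom (homD_lin f g)).
Proof. by move=> f; apply: hom_ext => x /=; rewrite addNr. Qed.
HB.instance Definition _ := GRing.isZmodule.Build (hom M N)
  hom_addA hom_addC hom_add0 hom_addN.

Fact hom_scaleA a b (f : hom M N) :
  mkhom (homZ_lin a (mkhom (homZ_lin b f))) = mkhom (homZ_lin (a * b) f).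
Proof. by apply: hom_ext => x /=; rewrite scalerA. Qed.
Fact hom_scale1 : left_id 1 (fun r f => mkhom (homZ_lin r f)).
Proof. by move=> f; apply: hom_ext => x /=; rewrite scale1r. Qed.
Fact hom_scaleDr : right_distributive (fun r f => mkhom (homZ_lin r f)) +%R.
Proof. by move=> a f g; apply: hom_ext => x /=; rewrite scalerDr. Qed.
Fact hom_scaleDl f : {morph (fun r => mkhom (homZ_lin r f)) : a b / a + b}.
Proof. by move=> a b; apply: hom_ext => x /=; rewrite scalerDl. Qed.
HB.instance Definition _ := GRing.Zmodule_isLmodule.Build R (hom M N)
  hom_scaleA hom_scale1 hom_scaleDr hom_scaleDl.

Lemma homDE (f g : hom M N) x : (f + g) x = f x + g x. Proof. by []. Qed.
Lemma homZE r (f : hom M N) x : (r *: f) x = r *: f x. Proof. by []. Qed.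
Lemma homPE r (f g : hom M N) x : (r *: f + g) x = r *: f x + g x. Proof. by []. Qed.
Lemma hom0E x : (0 : hom M N) x = 0. Proof. by []. Qed.
Lemma hom_sumE I (s : seq I) (P : pred I) (F : I -> hom M N) x :
  (\sum_(i <- s | P i) F i) x = \sum_(i <- s | P i) F i x.
Proof. by elim/big_rec2: _ => [|i y f _ <-]; rewrite ?hom0E ?homDE. Qed.

End Hom.

Section HomOps.
Variable R : comPzRingType.

Definition hom_id (M : lmodType R) : hom M M :=
  mkhom (fun a u v => erefl : idfun (a *: u + v) = a *: u + v).

Fact hom_comp_lin (M N L : lmodType R) (g : hom N L) (f : hom M N) :
  linear (fun x => g (f x)).
Proof. by move=> a u v; rewrite !linearP. Qed.
Definition hom_comp (M N L : lmodType R) (g : hom N L) (f : hom M N) : hom M L :=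
  mkhom (hom_comp_lin g f).

Lemma hom_inv_ex (M N : lmodType R) (f : hom M N) : bijective f ->
  exists g : hom N M, cancel f g /\ cancel g f.
Proof.
case=> g fK gK; have lg : linear g.
  by move=> a u v; apply: (can_inj fK); rewrite linearP !gK.
by exists (mkhom lg).
Qed.

Definition bilinear_map (M N L : lmodType R) (f : M -> N -> L) : Prop :=
  (forall n, linear (f^~ n)) /\ (forall m, linear (f m)).

End HomOps.

(* M \otimes_R N is the quotient of the free commutative monoid on M * N
   (finite formal sums, written as sequences) by the congruence generated by
   the bilinearity relations.  This quotient is already a group, with
   - (m \otimes n) = (- m) \otimes n, so that it is the usual tensor product:
   see tens_lift below for its universal property. *)
Inductive tens_rel (R : comPzRingType) (M N : lmodType R) :
    seq (M * N) -> seq (M * N) -> Prop :=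
| TensRefl s : tens_rel s s
| TensSym s t : tens_rel s t -> tens_rel t s
| TensTrans s t u : tens_rel s t -> tens_rel t u -> tens_rel s u
| TensCat s s' t t' :
    tens_rel s s' -> tens_rel t t' -> tens_rel (s ++ t) (s' ++ t')
| TensComm s t : tens_rel (s ++ t) (t ++ s)
| TensZero n : tens_rel [:: (0, n)] [::]
| TensAddl m m' n : tens_rel [:: (m + m', n)] [:: (m, n); (m', n)]
| TensAddr m n n' : tens_rel [:: (m, n + n')] [:: (m, n); (m, n')]
| TensBal r m n : tens_rel [:: (r *: m, n)] [:: (m, r *: n)].

Section Tensor.
Variables (R : comPzRingType) (M N : lmodType R).
Implicit Types s t : seq (M * N).

Definition tens_relb s t : bool := `[< tens_rel s t >].
Fact tens_relb_refl : reflexive tens_relb.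
Proof. by move=> s; apply/asboolP; apply: TensRefl. Qed.
Fact tens_relb_sym : symmetric tens_relb.
Proof. by move=> s t; apply/asboolP/asboolP => /TensSym. Qed.
Fact tens_relb_trans : transitive tens_relb.
Proof. by move=> t s u /asboolP st /asboolP tu; apply/asboolP/(TensTrans st). Qed.
Canonical tens_equiv :=
  EquivRel tens_relb tens_relb_refl tens_relb_sym tens_relb_trans.

Definition tens := {eq_quot tens_equiv}.
HB.instance Definition _ := Choice.on tens.
HB.instance Definition _ := EqQuotient.on tens.

Definition tcls s : tens := \pi_tens s.

Lemma tclsP s t : tcls s = tcls t <-> tens_rel s t.
Proof.
split=> [/eqmodP/asboolP//|st]; by apply/eqmodP/asboolP.
Qed.

Lemma tcls_repr (x : tens) : tcls (repr x) = x.
Proof. exact: reprK. Qed.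

Lemma tens_repr_rel s : tens_rel (repr (tcls s)) s.
Proof. by apply/tclsP; rewrite tcls_repr. Qed.

Definition tscale_seq (r : R) s := [seq (r *: p.1, p.2) | p <- s].

Lemma tscale_seq_rel r s t : tens_rel s t ->
  tens_rel (tscale_seq r s) (tscale_seq r t).
Proof.
elim=> {s t} [s|s t _|s t u _ IH1 _|s s' t t' _ IH1 _ IH2|s t|n|m m' n|m n n'|a m n].
- exact: TensRefl.
- exact: TensSym.
- exact: TensTrans.
- by rewrite /tscale_seq !map_cat; apply: TensCat.
- by rewrite /tscale_seq !map_cat; apply: TensComm.
- by rewrite /= scaler0; apply: TensZero.
- by rewrite /= scalerDr; apply: TensAddl.
- exact: TensAddr.
- by rewrite /= scalerA mulrC -scalerA; apply: TensBal.
Qed.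

Definition tens_add (x y : tens) : tens := tcls (repr x ++ repr y).
Definition tens_scale r (x : tens) : tens := tcls (tscale_seq r (repr x)).

Lemma tens_add_cls s t : tens_add (tcls s) (tcls t) = tcls (s ++ t).
Proof. by apply/tclsP; apply: TensCat; apply: tens_repr_rel. Qed.

Lemma tens_scale_cls r s : tens_scale r (tcls s) = tcls (tscale_seq r s).
Proof. by apply/tclsP; apply: tscale_seq_rel; apply: tens_repr_rel. Qed.

Fact tens_addA : associative tens_add.
Proof.
move=> x y z; rewrite -[x]tcls_repr -[y]tcls_repr -[z]tcls_repr.
by rewrite !tens_add_cls catA.
Qed.
Fact tens_addC : commutative tens_add.
Proof. by move=> x y; apply/tclsP/TensComm. Qed.
Fact tens_add0 : left_id (tcls [::]) tens_add.
Proof. by move=> x; rewrite -[x]tcls_repr tens_add_cls. Qed.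
HB.instance Definition _ :=
  GRing.isNmodule.Build tens tens_addA tens_addC tens_add0.

Lemma tclsD s t : tcls (s ++ t) = tcls s + tcls t.
Proof. by rewrite -tens_add_cls. Qed.
Lemma tcls_cons p s : tcls (p :: s) = tcls [:: p] + tcls s.
Proof. exact: (tclsD [:: p]). Qed.
Lemma tcls0 : tcls [::] = 0. Proof. by []. Qed.

Lemma tens_ind0 (P : tens -> Prop) : P 0 ->
  (forall p x, P x -> P (tcls [:: p] + x)) -> forall x, P x.
Proof.
move=> P0 PD x; rewrite -(tcls_repr x); elim: (repr x) => [|p s IH] //.
by rewrite tcls_cons; apply: PD.
Qed.

Fact tens_scaleA a b x : tens_scale a (tens_scale b x) = tens_scale (a * b) x.
Proof.
rewrite -[x]tcls_repr !tens_scale_cls; congr tcls; rewrite /tscale_seq -map_comp.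
by apply: eq_map => p /=; rewrite scalerA.
Qed.
Fact tens_scale0 x : tens_scale 0 x = 0.
Proof.
rewrite -[x]tcls_repr tens_scale_cls; elim: (repr x) => [|p s IH] //=.
rewrite tcls_cons IH addr0 scale0r; exact/tclsP/TensZero.
Qed.
Fact tens_scale1 : left_id 1 tens_scale.
Proof.
move=> x; rewrite -[x]tcls_repr tens_scale_cls; congr tcls.
by rewrite -[RHS]map_id; apply: eq_map => -[m n] /=; rewrite scale1r.
Qed.
Fact tens_scaleDr : right_distributive tens_scale +%R.
Proof.
move=> a x y; rewrite -[x]tcls_repr -[y]tcls_repr -tclsD !tens_scale_cls.
by rewrite /tscale_seq map_cat tclsD.
Qed.
Fact tens_scaleDl x : {morph tens_scale^~ x : a b / a + b}.
Proof.
move=> a b; rewrite /= -[x]tcls_repr !tens_scale_cls.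
elim: (repr x) => [|p s IH]; first by rewrite /= tcls0 addr0.
rewrite /= tcls_cons IH [in RHS]tcls_cons [X in _ = _ + X]tcls_cons addrACA.
congr (_ + _); rewrite -tcls_cons; apply/tclsP; rewrite scalerDl; apply: TensAddl.
Qed.
HB.instance Definition _ := GRing.Nmodule_isLSemiModule.Build R tens
  tens_scaleA tens_scale0 tens_scale1 tens_scaleDr tens_scaleDl.
HB.instance Definition _ := GRing.LSemiModule_isLmodule.Build R tens.

Definition pure (m : M) (n : N) : tens := tcls [:: (m, n)].

Lemma tclsZ r s : r *: tcls s = tcls (tscale_seq r s).
Proof. exact: tens_scale_cls. Qed.

Lemma pure_linl n : linear (pure^~ n).
Proof.
by move=> a u v; rewrite /= /pure tclsZ -tclsD; apply/tclsP/TensAddl.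
Qed.

Lemma pure_linr m : linear (pure m).
Proof.
move=> a u v; rewrite /pure tclsZ -tclsD; apply/tclsP.
apply: TensTrans (TensAddr _ _ _) _; apply: (@TensCat _ _ _ [:: _] [:: _] [:: _] [:: _]).
  exact/TensSym/TensBal.
exact: TensRefl.
Qed.

Lemma pure_bilinear : bilinear_map pure.
Proof. by split; [apply: pure_linl | apply: pure_linr]. Qed.

Lemma tens_ind (P : tens -> Prop) : (forall m n, P (pure m n)) ->
  (forall x y, P x -> P y -> P (x + y)) -> forall x, P x.
Proof.
move=> Pp PD; apply: tens_ind0 => [|[m n] x Px]; last exact: (PD _ _ (Pp m n)).
rewrite -tcls0; have <- : pure 0 0 = tcls [::] by apply/tclsP; apply: TensZero.
exact: Pp.
Qed.

Section Lift.
Variables (L : lmodType R) (f : M -> N -> L) (bil_f : bilinear_map f).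

Definition seq_lift s : L := \sum_(p <- s) f p.1 p.2.

Let linl n : {linear M -> L} := mkhom (bil_f.1 n).
Let linr m : {linear N -> L} := mkhom (bil_f.2 m).

Lemma seq_lift_rel s t : tens_rel s t -> seq_lift s = seq_lift t.
Proof.
elim=> {s t} [s|s t _|s t u _ IH1 _|s s' t t' _ IH1 _ IH2|s t|n|m m' n|m n n'|a m n];
  rewrite /seq_lift ?big_cat ?big_cons ?big_nil ?addr0 //=.
- by rewrite -!/(seq_lift _) IH1; apply.
- by rewrite -!/(seq_lift _) IH1 IH2.
- exact: addrC.
- exact: (linear0 (linl n)).
- exact: (linearD (linl n)).
- exact: (linearD (linr m)).
- by have /= -> := linearZ_LR (linl n); have /= -> := linearZ_LR (linr m).
Qed.

Lemma seq_lift_cls s : seq_lift (repr (tcls s)) = seq_lift s.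
Proof. exact/seq_lift_rel/tens_repr_rel. Qed.

Fact tens_lift_lin : linear (fun x : tens => seq_lift (repr x)).
Proof.
move=> a x y; rewrite -[x]tcls_repr -[y]tcls_repr tclsZ -tclsD !seq_lift_cls.
rewrite /seq_lift big_cat big_map scaler_sumr /=; congr (_ + _).
by apply: eq_bigr => p _; have /= -> := linearZ_LR (linl p.2).
Qed.
Definition tens_lift : hom tens L := mkhom tens_lift_lin.

Lemma tens_lift_pure m n : tens_lift (pure m n) = f m n.
Proof. by rewrite /= seq_lift_cls /seq_lift big_seq1. Qed.

End Lift.

Lemma tens_hom_ext (L : lmodType R) (f g : hom tens L) :
  (forall m n, f (pure m n) = g (pure m n)) -> f =1 g.
Proof.
by move=> eq_fg; elim/tens_ind => // x y IHx IHy; rewrite !linearD IHx IHy.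
Qed.

End Tensor.


Section TensorHom.
Variable R : comPzRingType.
Implicit Types M N L Z : lmodType R.

Lemma pureDl M N (m m' : M) (n : N) : pure (m + m') n = pure m n + pure m' n.
Proof. by have := pure_linl n 1 m m'; rewrite !scale1r. Qed.
Lemma pureDr M N (m : M) (n n' : N) : pure m (n + n') = pure m n + pure m n'.
Proof. by have := pure_linr m 1 n n'; rewrite !scale1r. Qed.
Lemma pureZl M N r (m : M) (n : N) : pure (r *: m) n = r *: pure m n.
Proof. exact: (linearZ_LR (mkhom (pure_linl n))). Qed.
Lemma pureZr M N r (m : M) (n : N) : pure m (r *: n) = r *: pure m n.
Proof. exact: (linearZ_LR (mkhom (pure_linr m))). Qed.
Lemma pure_suml M N I (s : seq I) (P : pred I) F (n : N) :
  pure (\sum_(i <- s | P i) F i : M) n = \sum_(i <- s | P i) pure (F i) n.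
Proof. exact: (linear_sum (mkhom (pure_linl n))). Qed.
Lemma pure_sumr M N I (s : seq I) (P : pred I) F (m : M) :
  pure m (\sum_(i <- s | P i) F i : N) = \sum_(i <- s | P i) pure m (F i).
Proof. exact: (linear_sum (mkhom (pure_linr m))). Qed.

Fact uncurry_bil M N L (F : hom M (hom N L)) : bilinear_map (fun m n => F m n).
Proof. by split=> [n|m] a u v; rewrite linearP. Qed.
Definition tens_uncurry M N L (F : hom M (hom N L)) : hom (tens M N) L :=
  tens_lift (uncurry_bil F).
Lemma tens_uncurryE M N L (F : hom M (hom N L)) m n :
  tens_uncurry F (pure m n) = F m n.
Proof. exact: tens_lift_pure. Qed.

Fact tmap_bil M N M' N' (f : hom M M') (g : hom N N') :
  bilinear_map (fun m n => pure (f m) (g n)).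
Proof. by split=> [n|m] a u v; rewrite linearP ?pure_linl ?pure_linr. Qed.
Definition tmap M N M' N' (f : hom M M') (g : hom N N') :
  hom (tens M N) (tens M' N') := tens_lift (tmap_bil f g).
Lemma tmapE M N M' N' (f : hom M M') (g : hom N N') m n :
  tmap f g (pure m n) = pure (f m) (g n).
Proof. exact: tens_lift_pure. Qed.

Lemma tmap_bilinear M N M' N' :
  bilinear_map (fun (f : hom M M') (g : hom N N') => tmap f g).
Proof.
split=> [g|f] a u v; apply: hom_ext; apply: tens_hom_ext => m n.
  by rewrite homPE !tmapE homPE pure_linl.
by rewrite homPE !tmapE homPE pure_linr.
Qed.

Lemma tmap_bij M N M' N' (f : hom M M') (g : hom N N') :
  bijective f -> bijective g -> bijective (tmap f g).
Proof.
move=> /hom_inv_ex[f' [fK f'K]] /hom_inv_ex[g' [gK g'K]].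
exists (tmap f' g').
  by elim/tens_ind => [m n|x y IHx IHy]; rewrite ?linearD ?IHx ?IHy // !tmapE fK gK.
by elim/tens_ind => [m n|x y IHx IHy]; rewrite ?linearD ?IHx ?IHy // !tmapE f'K g'K.
Qed.

Fact tens_swap_bil M N : bilinear_map (fun (m : M) (n : N) => pure n m).
Proof. by split=> [n|m] a u v; rewrite ?pure_linl ?pure_linr. Qed.
Definition tens_swap M N : hom (tens M N) (tens N M) :=
  tens_lift (@tens_swap_bil M N).
Lemma tens_swapE M N (m : M) (n : N) : tens_swap M N (pure m n) = pure n m.
Proof. exact: tens_lift_pure. Qed.
Lemma tens_swapK M N : cancel (tens_swap M N) (tens_swap N M).
Proof.
by elim/tens_ind => [m n|x y IHx IHy]; rewrite ?linearD ?IHx ?IHy // !tens_swapE.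
Qed.

Fact tens_unit_bil M : bilinear_map (fun (r : R^o) (m : M) => r *: m).
Proof.
split=> [m|r] a u v; first by rewrite scalerDl scalerA.
by rewrite scalerDr !scalerA mulrC.
Qed.
Definition tens_unit M : hom (tens R^o M) M := tens_lift (@tens_unit_bil M).
Lemma tens_unitE M (r : R^o) (m : M) : tens_unit M (pure r m) = r *: m.
Proof. exact: tens_lift_pure. Qed.
Lemma tens_unit_bij M : bijective (tens_unit M).
Proof.
exists (pure (1 : R^o)) => [|m]; last by rewrite tens_unitE scale1r.
elim/tens_ind => [r m|x y IHx IHy]; last by rewrite linearD pureDr IHx IHy.
by rewrite tens_unitE pureZr -pureZl /GRing.scale /= mulr1.
Qed.

Section Assoc.
Variables M N L : lmodType R.
Definition pure_hom M' N' (m : M') : hom N' (tens M' N') := mkhom (@pure_linr R M' N' m).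
Fact tassoc_bil :
  bilinear_map (fun (m : M) (n : N) =>
    hom_comp (pure_hom (tens N L) m) (pure_hom L n)).
Proof.
by split=> [n|m] a u v; apply: hom_ext => l; rewrite homPE /= ?pure_linl ?pure_linr.
Qed.
Definition tassoc : hom (tens (tens M N) L) (tens M (tens N L)) :=
  tens_uncurry (tens_lift tassoc_bil).
Lemma tassocE m n l : tassoc (pure (pure m n) l) = pure m (pure n l).
Proof. by rewrite tens_uncurryE tens_lift_pure. Qed.

Fact tassoc'_lin : linear (fun m : M => tmap (pure_hom N m) (hom_id L)).
Proof.
move=> a u v; apply: hom_ext; apply: tens_hom_ext => n l.
by rewrite homPE !tmapE /= !pure_linl.
Qed.
Definition tassoc' : hom (tens M (tens N L)) (tens (tens M N) L) :=
  tens_uncurry (mkhom tassoc'_lin).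
Lemma tassoc'E m n l : tassoc' (pure m (pure n l)) = pure (pure m n) l.
Proof. by rewrite tens_uncurryE tmapE. Qed.

Lemma tassoc_bij : bijective tassoc.
Proof.
exists tassoc'.
  elim/tens_ind => [x l|x y IHx IHy]; last by rewrite !linearD IHx IHy.
  elim/tens_ind: x => [m n|x y IHx IHy]; first by rewrite tassocE tassoc'E.
  by rewrite pureDl !linearD IHx IHy.
elim/tens_ind => [m x|x y IHx IHy]; last by rewrite !linearD IHx IHy.
elim/tens_ind: x => [n l|x y IHx IHy]; first by rewrite tassoc'E tassocE.
by rewrite pureDr !linearD IHx IHy.
Qed.
End Assoc.

Section Interchange.
Variables A A' B B' : lmodType R.
Fact tinter_bil : bilinear_map (fun (a : A) (a' : A') =>
  tmap (pure_hom B a) (pure_hom B' a')).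
Proof.
split=> [a'|a] r u v; apply: hom_ext; apply: tens_hom_ext => b b';
  by rewrite homPE !tmapE /= ?pure_linl ?pure_linr.
Qed.
Definition tinter : hom (tens (tens A A') (tens B B')) (tens (tens A B) (tens A' B')) :=
  tens_uncurry (tens_lift tinter_bil).
Lemma tinterE a a' b b' :
  tinter (pure (pure a a') (pure b b')) = pure (pure a b) (pure a' b').
Proof. by rewrite tens_uncurryE tens_lift_pure tmapE. Qed.
End Interchange.

Lemma tens_ind4 (A A' B B' : lmodType R)
   (P : tens (tens A A') (tens B B') -> Prop) :
  (forall a a' b b', P (pure (pure a a') (pure b b'))) ->
  (forall x y, P x -> P y -> P (x + y)) -> forall x, P x.
Proof.
move=> Pp PD; elim/tens_ind => // x y.
elim/tens_ind: x => [a a'|x x' IH IH']; last by rewrite pureDl; apply: PD.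
elim/tens_ind: y => [b b'|y y' IH IH'] //; by rewrite pureDr; apply: PD.
Qed.

Lemma tinterK (A A' B B' : lmodType R) :
  cancel (@tinter A A' B B') (@tinter A B A' B').
Proof.
elim/tens_ind4 => [a a' b b'|x y IHx IHy]; first by rewrite !tinterE.
by rewrite !linearD IHx IHy.
Qed.

Lemma tinter_bij (A A' B B' : lmodType R) : bijective (@tinter A A' B B').
Proof. by exists (@tinter A B A' B'); apply: tinterK. Qed.

End TensorHom.

Section Modules.
Variable R : comPzRingType.
Implicit Types P Q M N : lmodType R.

Definition mod_iso M N : Prop := exists f : hom M N, bijective f.

Definition faithful_mod P : Prop :=
  forall r : R, (forall x : P, r *: x = 0) -> r = 0.

Definition fingen_mod P : Prop :=
  exists n (x : 'I_n -> P), forall z, exists c : 'I_n -> R,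
    z = \sum_(i < n) c i *: x i.

Definition projective_mod P : Prop :=
  forall (M N : lmodType R) (g : hom M N) (f : hom P N),
    (forall y, exists x, g x = y) -> exists h : hom P M, forall x, g (h x) = f x.

(* faithful finitely generated projective *)
Definition ffgp_mod P : Prop :=
  [/\ faithful_mod P, fingen_mod P & projective_mod P].

Definition basis_mod P (B : P -> Prop) : Prop :=
  (forall (s : seq P) (c : P -> R), uniq s -> (forall x, x \in s -> B x) ->
     \sum_(x <- s) c x *: x = 0 -> forall x, x \in s -> c x = 0) /\
  (forall z, exists (s : seq P) (c : P -> R),
     (forall x, x \in s -> B x) /\ z = \sum_(x <- s) c x *: x).

Definition free_mod P : Prop := exists B : P -> Prop, basis_mod B.

(* 'rV[R]_n is the free module R^n *)
Definition stably_tensor_free P : Prop :=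
  exists n m : nat,
    [/\ (0 < n)%N, (0 < m)%N & mod_iso (tens P 'rV[R]_n) 'rV[R]_m].

Definition dual_basis (I : finType) P (x : I -> P) (f : I -> hom P R^o) : Prop :=
  forall z, z = \sum_i f i z *: x i.

Lemma dual_basis_ex P : fingen_mod P -> projective_mod P ->
  exists n (x : 'I_n -> P) f, dual_basis x f.
Proof.
move=> [n [x gen_x]] proj_P.
have lin_g : linear (fun c : 'rV[R]_n => \sum_i c 0 i *: x i).
  move=> a u v; rewrite scaler_sumr -big_split; apply: eq_bigr => i _ /=.
  by rewrite !mxE scalerDl scalerA.
have [|h hK] := proj_P _ _ (mkhom lin_g) (hom_id P).
  move=> z; have [c ->] := gen_x z; exists (\row_i c i).
  by apply: eq_bigr => i _; rewrite mxE.
have lin_f i : linear (fun z => h z 0 i : R^o).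
  by move=> a u v; rewrite linearP !mxE.
by exists n, x, (fun i => mkhom (lin_f i)) => z; rewrite -[LHS]hK.
Qed.

Lemma dual_basis_fingen (I : finType) P (x : I -> P) f :
  dual_basis x f -> fingen_mod P.
Proof.
move=> xf; exists #|I|, (x \o enum_val) => z.
exists (fun i => f (enum_val i) z); rewrite {1}(xf z).
by rewrite (reindex_onto (@enum_val I predT) enum_rank) //=;
  [apply: eq_bigl => i; rewrite enum_valK eqxx | move=> i _; rewrite enum_rankK].
Qed.

Lemma dual_basis_proj (I : finType) P (x : I -> P) f :
  dual_basis x f -> projective_mod P.
Proof.
move=> xf M N g u surj_g.
have [y yP] := choice (fun i => surj_g (u (x i))).
have lin_h : linear (fun z => \sum_i f i z *: y i).
  move=> a z z'; rewrite scaler_sumr -big_split; apply: eq_bigr => i _ /=.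
  by rewrite linearP /= scalerDl scalerA.
exists (mkhom lin_h) => z /=; rewrite [in RHS](xf z) !linear_sum.
by apply: eq_bigr => i _; rewrite (linearZ_LR g) (linearZ_LR u) yP.
Qed.

Lemma ffgpP P : ffgp_mod P <->
  faithful_mod P /\ exists (I : finType) (x : I -> P) f, dual_basis x f.
Proof.
split=> [[ffP fgP prP]|[ffP [I [x [f xf]]]]].
  split=> //; have [n [x [f xf]]] := dual_basis_ex fgP prP.
  by exists 'I_n, x, f.
by split; [| exact: dual_basis_fingen xf | exact: dual_basis_proj xf].
Qed.

Lemma ffgp_iso P Q : mod_iso P Q -> ffgp_mod P -> ffgp_mod Q.
Proof.
move=> [u /hom_inv_ex[v [uK vK]]] /ffgpP[ffP [I [x [f xf]]]].
apply/ffgpP; split.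
  move=> r rQ; apply: ffP => z; apply: (can_inj uK).
  by rewrite linearZ_LR linear0.
exists I, (u \o x), (fun i => hom_comp (f i) v) => z.
by rewrite -[LHS]vK {1}[v z]xf linear_sum; apply: eq_bigr => i _; rewrite linearZ_LR.
Qed.

Fact tens_form_bil P Q (f : hom P R^o) (g : hom Q R^o) :
  bilinear_map (fun p q => f p * g q : R^o).
Proof.
split=> [q|p] a u v; rewrite linearP /=.
  by rewrite mulrDl /GRing.scale /= mulrA.
by rewrite mulrDr /GRing.scale /= mulrCA.
Qed.
Definition tens_form P Q (f : hom P R^o) (g : hom Q R^o) : hom (tens P Q) R^o :=
  tens_lift (tens_form_bil f g).

Lemma ffgp_tens P Q : ffgp_mod P -> ffgp_mod Q -> ffgp_mod (tens P Q).
Proof.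
move=> /ffgpP[ffP [I [x [f xf]]]] /ffgpP[ffQ [J [y [g yg]]]].
apply/ffgpP; split.
  move=> r r0; apply: ffP => p; rewrite (xf p) scaler_sumr.
  rewrite big1 // => i _; rewrite scalerA (_ : r * _ = 0) ?scale0r //.
  apply: ffQ => q; rewrite -scalerA.
  have : tens_unit Q (tmap (f i) (hom_id Q) (r *: pure p q)) = 0.
    by rewrite r0 !linear0.
  by rewrite (linearZ_LR (tmap _ _)) (linearZ_LR (tens_unit Q)) tmapE tens_unitE.
exists (I * J)%type, (fun ij => pure (x ij.1) (y ij.2)),
  (fun ij => tens_form (f ij.1) (g ij.2)).
elim/tens_ind => [p q|z z' IH IH']; last first.
  rewrite {1}IH {1}IH' -big_split; apply: eq_bigr => i _.
  by rewrite linearD scalerDl.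
rewrite {1}(xf p) pure_suml.
under eq_bigr => i _ do rewrite {1}(yg q) pure_sumr.
rewrite pair_big; apply: eq_bigr => ij _.
by rewrite tens_lift_pure pureZl pureZr scalerA.
Qed.

Fact theta_lin0 P Q (f : hom P R^o) (q : Q) : linear (fun z => f z *: q).
Proof. by move=> a u v; rewrite linearP /= scalerDl scalerA. Qed.
Definition theta P Q (f : hom P R^o) (q : Q) : hom P Q := mkhom (theta_lin0 f q).
Lemma thetaE P Q (f : hom P R^o) (q : Q) z : theta f q z = f z *: q.
Proof. by []. Qed.
Lemma theta_lin P Q (f : hom P R^o) : linear (@theta P Q f).
Proof.
move=> a u v; apply: hom_ext => z.
by rewrite homPE !thetaE scalerDr !scalerA mulrC.
Qed.

Lemma theta_sum P Q (f : hom P R^o) I (s : seq I) (p : pred I) (F : I -> Q) :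
  theta f (\sum_(i <- s | p i) F i) = \sum_(i <- s | p i) theta f (F i).
Proof. exact: (linear_sum (mkhom (@theta_lin P Q f))). Qed.
Lemma thetaD P Q (f : hom P R^o) (q q' : Q) : theta f (q + q') = theta f q + theta f q'.
Proof. exact: (linearD (mkhom (@theta_lin P Q f))). Qed.
Lemma thetaZ P Q (f : hom P R^o) (r : R) (q : Q) : theta f (r *: q) = r *: theta f q.
Proof. exact: (linearZ_LR (mkhom (@theta_lin P Q f))). Qed.

Lemma theta_dual (I : finType) P Q (x : I -> P) f (u : hom P Q) :
  dual_basis x f -> u = \sum_i theta (f i) (u (x i)).
Proof.
move=> xf; apply: hom_ext => z; rewrite hom_sumE {1}(xf z) linear_sum.
by apply: eq_bigr => i _; rewrite linearZ_LR.
Qed.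

Definition tens_hom P P' Q Q' :
  hom (tens (hom P P') (hom Q Q')) (hom (tens P Q) (tens P' Q')) :=
  tens_lift (@tmap_bilinear R P Q P' Q').
Lemma tens_homE P P' Q Q' (u : hom P P') (v : hom Q Q') :
  tens_hom P P' Q Q' (pure u v) = tmap u v.
Proof. exact: tens_lift_pure. Qed.

Lemma tens_hom_bij P P' Q Q' (I J : finType) (x : I -> P) f (y : J -> Q) g :
  dual_basis x f -> dual_basis y g -> bijective (tens_hom P P' Q Q').
Proof.
move=> xf yg.
pose rho i j := tmap (mkhom (@theta_lin P P' (f i))) (mkhom (@theta_lin Q Q' (g j))).
have rhoE i j t p q : tens_hom P P' Q Q' (rho i j t) (pure p q) = (f i p * g j q) *: t.
  elim/tens_ind: t => [p' q'|t t' IH IH'].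
    by rewrite tmapE tens_homE tmapE /= pureZl pureZr scalerA.
  by rewrite !linearD homDE IH IH'.
exists (fun F : hom (tens P Q) (tens P' Q') => \sum_i \sum_j rho i j (F (pure (x i) (y j)))).
  elim/tens_ind => [u v|t t' IH IH'].
    rewrite {2}(theta_dual u xf) pure_suml; apply: eq_bigr => i _.
    rewrite {2}(theta_dual v yg) pure_sumr; apply: eq_bigr => j _.
    by rewrite tens_homE tmapE tmapE.
  rewrite linearD -{2}IH -{2}IH' -big_split; apply: eq_bigr => i _.
  by rewrite -big_split; apply: eq_bigr => j _; rewrite homDE linearD.
move=> F; apply: hom_ext; apply: tens_hom_ext => p q.
rewrite linear_sum hom_sumE {2}(xf p) pure_suml linear_sum; apply: eq_bigr => i _.
rewrite linear_sum hom_sumE {2}(yg q) pure_sumr linear_sum; apply: eq_bigr => j _.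
by rewrite rhoE pureZl pureZr !(linearZ_LR F) scalerA.
Qed.

Lemma ffgp_hom P : ffgp_mod P -> ffgp_mod (hom P P).
Proof.
move=> /ffgpP[ffP [I [x [f xf]]]]; apply/ffgpP; split.
  move=> r r0; apply: ffP => z.
  by have := congr1 (fun u : hom P P => u z) (r0 (hom_id P)).
have lin_c i j : linear (fun u : hom P P => f j (u (x i)) : R^o).
  by move=> a u v; rewrite homPE linearP.
exists (I * I)%type, (fun ij => theta (f ij.1) (x ij.2)),
  (fun ij => mkhom (lin_c ij.1 ij.2)) => u.
rewrite {1}(theta_dual u xf) -(pair_bigA _ (fun i j => (f j (u (x i)) : R) *: theta (f i) (x j))).
apply: eq_bigr => i _; rewrite {1}(xf (u (x i))).
by rewrite theta_sum; apply: eq_bigr => j _; rewrite thetaZ.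
Qed.

Lemma ffgp_rV n : (0 < n)%N -> ffgp_mod 'rV[R]_n.
Proof.
move=> n_gt0; apply/ffgpP; split.
  move=> r r0; have /rowP/(_ (Ordinal n_gt0)) := r0 (const_mx 1).
  by rewrite !mxE mulr1.
have lin_c i : linear (fun u : 'rV[R]_n => u 0 i : R^o) by move=> a u v; rewrite !mxE.
exists 'I_n, (fun i => delta_mx 0 i), (fun i => mkhom (lin_c i)) => z.
exact: row_sum_delta.
Qed.

End Modules.

Record algebra (R : comPzRingType) := Algebra {
  alg_mod :> lmodType R;
  amul : alg_mod -> alg_mod -> alg_mod;
  aone : alg_mod;
  amul_bilinear : bilinear_map amul;
  amulA : associative amul;
  amul1l : left_id aone amul;
  amul1r : right_id aone amul
}.
Arguments amul {R a}.
Arguments aone {R a}.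

Section Algebras.
Variable R : comPzRingType.
Implicit Types A B C : algebra R.

Definition alg_morphism A B (f : hom A B) : Prop :=
  f aone = aone /\ {morph f : x y / amul x y}.

Definition alg_iso A B : Prop :=
  exists f : hom A B, alg_morphism f /\ bijective f.

Fact base_alg_bil : bilinear_map (fun x y : R^o => (x * y : R^o)).
Proof.
split=> [n|m] a u v; first by rewrite mulrDl -mulrA.
by rewrite mulrDr; congr (_ + _); rewrite /GRing.scale /= mulrCA.
Qed.
Definition base_alg : algebra R :=
  @Algebra R R^o *%R 1 base_alg_bil (@mulrA _) (@mul1r _) (@mulr1 _).

Fact mx_alg_bil n : bilinear_map (fun x y : 'M[R]_n => x *m y).
Proof.
by split=> [y|x] a u v; rewrite ?mulmxDl ?mulmxDr -?scalemxAl -?scalemxAr.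
Qed.
Definition mx_alg n : algebra R :=
  @Algebra R 'M[R]_n mulmx 1%:M (mx_alg_bil n)
    (@mulmxA R n n n n) (@mul1mx R n n) (@mulmx1 R n n).

Fact end_alg_bil (P : lmodType R) : bilinear_map (@hom_comp R P P P).
Proof. by split=> [v|u] a w w'; apply: hom_ext => x //=; rewrite linearP. Qed.
Fact end_algA (P : lmodType R) : associative (@hom_comp R P P P).
Proof. by move=> u v w; apply: hom_ext. Qed.
Fact end_alg1l (P : lmodType R) : left_id (hom_id P) (@hom_comp R P P P).
Proof. by move=> u; apply: hom_ext. Qed.
Fact end_alg1r (P : lmodType R) : right_id (hom_id P) (@hom_comp R P P P).
Proof. by move=> u; apply: hom_ext. Qed.
Definition end_alg (P : lmodType R) : algebra R :=
  @Algebra R (hom P P) (@hom_comp R P P P) (hom_id P)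
    (end_alg_bil P) (@end_algA P) (@end_alg1l P) (@end_alg1r P).

Fact opp_alg_bil A : bilinear_map (fun x y : A => amul y x).
Proof. by have [linl linr] := amul_bilinear A; split=> [n|m] a u v; rewrite ?linl ?linr. Qed.
Fact opp_algA A : associative (fun x y : A => amul y x).
Proof. by move=> x y z; rewrite amulA. Qed.
Definition opp_alg A : algebra R :=
  @Algebra R A (fun x y => amul y x) aone (opp_alg_bil A)
    (@opp_algA A) (@amul1r R A) (@amul1l R A).

Definition lmul A (a : A) : hom A A := mkhom ((amul_bilinear A).2 a).
Definition rmul A (a : A) : hom A A := mkhom ((amul_bilinear A).1 a).
Lemma lmul_lin A : linear (@lmul A).
Proof. by move=> a u v; apply: hom_ext => x /=; rewrite (amul_bilinear A).1. Qed.
Lemma rmul_lin A : linear (@rmul A).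
Proof. by move=> a u v; apply: hom_ext => x /=; rewrite (amul_bilinear A).2. Qed.

(* (a \otimes b)(a' \otimes b') = aa' \otimes bb', see tens_mulE *)
Fact tens_mul_bil A B :
  bilinear_map (fun (a : A) (b : B) => tmap (lmul a) (lmul b)).
Proof.
by split=> [b|a] r u v; rewrite lmul_lin ?(tmap_bilinear _ _ _ _).1 ?(tmap_bilinear _ _ _ _).2.
Qed.
Definition tens_mul A B : hom (tens A B) (hom (tens A B) (tens A B)) :=
  tens_lift (tens_mul_bil A B).
Lemma tens_mulE A B (a a' : A) (b b' : B) :
  tens_mul A B (pure a b) (pure a' b') = pure (amul a a') (amul b b').
Proof. by rewrite tens_lift_pure tmapE. Qed.

Fact tens_alg_bil A B : bilinear_map (fun x y => tens_mul A B x y).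
Proof. exact: uncurry_bil. Qed.
Fact tens_algA A B : associative (fun x y => tens_mul A B x y).
Proof.
move=> x y z; elim/tens_ind: x => [a b|x x' IH IH']; last first.
  by rewrite [in LHS]linearD homDE IH IH' (linearD (tens_mul A B) x) homDE (linearD (tens_mul A B)) homDE.
elim/tens_ind: y => [a' b'|y y' IH IH']; last first.
  rewrite (linearD (tens_mul A B) y) homDE (linearD (tens_mul A B _)) IH IH'.
  by rewrite (linearD (tens_mul A B _) y) (linearD (tens_mul A B)) homDE.
elim/tens_ind: z => [a'' b''|z z' IH IH']; last by rewrite !linearD IH IH'.
by rewrite !tens_mulE !amulA.
Qed.
Fact tens_alg1l A B : left_id (pure aone aone) (fun x y => tens_mul A B x y).
Proof.
elim/tens_ind => [a b|x y IHx IHy]; first by rewrite tens_mulE !amul1l.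
by rewrite linearD IHx IHy.
Qed.
Fact tens_alg1r A B : right_id (pure aone aone) (fun x y => tens_mul A B x y).
Proof.
elim/tens_ind => [a b|x y IHx IHy]; first by rewrite tens_mulE !amul1r.
by rewrite linearD homDE IHx IHy.
Qed.
Definition tens_alg A B : algebra R :=
  @Algebra R (tens A B) (fun x y => tens_mul A B x y) (pure aone aone)
    (tens_alg_bil A B) (@tens_algA A B) (@tens_alg1l A B) (@tens_alg1r A B).

Fact env_bil A :
  bilinear_map (fun (a : A) (b : opp_alg A) => hom_comp (lmul a) (@rmul A b)).
Proof.
split=> [b|a] r u v; rewrite ?lmul_lin ?rmul_lin.
  by rewrite (end_alg_bil A).1.
by rewrite (end_alg_bil A).2.
Qed.
(* a \otimes b |-> (x |-> axb) *)
Definition env_map A : hom (tens_alg A (opp_alg A)) (end_alg A) :=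
  tens_lift (env_bil A).
Lemma env_mapE A (a b x : A) : env_map A (pure a b) x = amul a (amul x b).
Proof. by rewrite tens_lift_pure. Qed.

(* env_map is a morphism of algebras (env_map_morphism), so that bijectivity
   says that it is an isomorphism. *)
Definition azumaya A : Prop := ffgp_mod A /\ bijective (env_map A).

Definition stably_matrix A : Prop :=
  exists n m : nat,
    [/\ (0 < n)%N, (0 < m)%N & alg_iso (tens_alg A (mx_alg n)) (mx_alg m)].

Lemma amulDl A (x y z : A) : amul (x + y) z = amul x z + amul y z.
Proof. exact: (linearD (rmul z)). Qed.
Lemma amulDr A (x y z : A) : amul x (y + z) = amul x y + amul x z.
Proof. exact: (linearD (lmul x)). Qed.

Lemma amul_tens A B (a a' : A) (b b' : B) :
  amul (pure a b : tens_alg A B) (pure a' b') = pure (amul a a') (amul b b').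
Proof. exact: tens_mulE. Qed.

(* multiplicativity can be checked on pure tensors *)
Lemma tens_morph A B C (f : hom (tens_alg A B) C) :
  (forall a a' b b', f (pure (amul a a') (amul b b')) =
     amul (f (pure a b)) (f (pure a' b'))) ->
  f (pure aone aone) = aone -> alg_morphism f.
Proof.
move=> fM f1; split=> // x y.
elim/tens_ind: x => [a b|x x' IH IH']; last by rewrite amulDl !linearD amulDl IH IH'.
elim/tens_ind: y => [a' b'|y y' IH IH']; last by rewrite amulDr !linearD amulDr IH IH'.
by rewrite amul_tens fM.
Qed.

Lemma env_map_morphism A : alg_morphism (env_map A).
Proof.
apply: tens_morph => [a a' b b'|]; apply: hom_ext => x; rewrite env_mapE /=.
  by rewrite !env_mapE /= !amulA.
by rewrite amul1l amul1r.
Qed.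

Lemma end_mulE (P : lmodType R) (u v : end_alg P) x : amul u v x = u (v x).
Proof. by []. Qed.

Lemma alg_iso_refl A : alg_iso A A.
Proof. by exists (hom_id A); split=> //; exists id. Qed.

Lemma alg_iso_sym A B : alg_iso A B -> alg_iso B A.
Proof.
move=> [f [[f1 fM] /hom_inv_ex[g [fK gK]]]]; exists g; split; last by exists f.
split; first by rewrite -f1 fK.
by move=> x y; apply: (can_inj fK); rewrite fM !gK.
Qed.

Lemma alg_iso_trans A B C : alg_iso A B -> alg_iso B C -> alg_iso A C.
Proof.
move=> [f [[f1 fM] bf]] [g [[g1 gM] bg]]; exists (hom_comp g f).
split; last exact: bij_comp.
by split=> [|x y] /=; rewrite ?f1 ?fM ?gM.
Qed.

Lemma alg_iso_tens A A' B B' :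
  alg_iso A A' -> alg_iso B B' -> alg_iso (tens_alg A B) (tens_alg A' B').
Proof.
move=> [f [[f1 fM] bf]] [g [[g1 gM] bg]]; exists (tmap f g).
split; last exact: tmap_bij.
apply: tens_morph => [a a' b b'|]; rewrite !tmapE ?f1 ?g1 //.
by rewrite fM gM amul_tens.
Qed.

Lemma alg_iso_tensC A B : alg_iso (tens_alg A B) (tens_alg B A).
Proof.
exists (tens_swap A B); split; last by exists (tens_swap B A); apply: tens_swapK.
by apply: tens_morph => [a a' b b'|]; rewrite !tens_swapE // amul_tens.
Qed.

Lemma alg_iso_tensA A B C :
  alg_iso (tens_alg (tens_alg A B) C) (tens_alg A (tens_alg B C)).
Proof.
exists (tassoc A B C); split; last exact: tassoc_bij.
apply: tens_morph => [x x' c c'|]; last by rewrite tassocE.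
elim/tens_ind: x => [a b|x y IHx IHy]; last first.
  by rewrite amulDl !pureDl !linearD amulDl IHx IHy.
elim/tens_ind: x' => [a' b'|x y IHx IHy]; last first.
  by rewrite amulDr !pureDl !linearD amulDr IHx IHy.
by rewrite amul_tens !tassocE !amul_tens.
Qed.

Lemma alg_iso_tens1 A : alg_iso (tens_alg base_alg A) A.
Proof.
exists (tens_unit A); split; last exact: tens_unit_bij.
apply: tens_morph => [a a' b b'|]; rewrite !tens_unitE ?scale1r //.
have /= -> := linearZ_LR (rmul (a' *: b')).
by have /= -> := linearZ_LR (lmul b); rewrite scalerA.
Qed.

Lemma alg_iso_end P Q : mod_iso P Q -> alg_iso (end_alg P) (end_alg Q).
Proof.
move=> [f /hom_inv_ex[g [fK gK]]].
have lin_c : linear (fun u : hom P P => hom_comp f (hom_comp u g)).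
  by move=> a u v; apply: hom_ext => x; rewrite homPE /= linearP.
exists (mkhom lin_c); split.
  split=> [|u v]; apply: hom_ext => x /=; first exact: gK.
  by rewrite fK.
exists (fun u : hom Q Q => hom_comp g (hom_comp u f)) => u; apply: hom_ext => x /=.
  by rewrite !fK.
by rewrite !gK.
Qed.

Lemma alg_iso_end_tens P Q : ffgp_mod P -> ffgp_mod Q ->
  alg_iso (tens_alg (end_alg P) (end_alg Q)) (end_alg (tens P Q)).
Proof.
move=> /ffgpP[_ [I [x [f xf]]]] /ffgpP[_ [J [y [g yg]]]].
exists (tens_hom P P Q Q); split; last exact: tens_hom_bij xf yg.
apply: tens_morph => [u u' v v'|]; rewrite !tens_homE;
  by apply: hom_ext; apply: tens_hom_ext => p q; rewrite ?end_mulE !tmapE.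
Qed.

Lemma alg_iso_mx_end n : alg_iso (mx_alg n) (end_alg 'rV[R]_n).
Proof.
have lin_m (a : 'M[R]_n) : linear (fun u : 'rV[R]_n => u *m a^T).
  by move=> r u v; rewrite mulmxDl -scalemxAl.
have lin_f : linear (fun a => mkhom (lin_m a)).
  move=> r a b; apply: hom_ext => u /=.
  by rewrite linearP /= mulmxDr -scalemxAr.
exists (mkhom lin_f : hom (mx_alg n) (end_alg 'rV[R]_n)); split.
  split=> [|a b]; apply: hom_ext => u /=; first by rewrite trmx1 mulmx1.
  by rewrite trmx_mul mulmxA.
exists (fun h : hom 'rV[R]_n 'rV[R]_n => (lin1_mx h)^T) => [a|h] /=.
  by apply/matrixP => i j; rewrite mxE [LHS]mxE /= -rowE !mxE.
by apply: hom_ext => u /=; rewrite trmxK mul_rV_lin1.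
Qed.

Lemma rV_tens n m : mod_iso (tens 'rV[R]_n 'rV[R]_m) 'rV[R]_(n * m).
Proof.
have bil : bilinear_map (fun (u : 'rV[R]_n) (v : 'rV[R]_m) => mxvec (u^T *m v)).
  split=> [v|u] a w w'.
    by rewrite linearP /= mulmxDl -scalemxAl linearP.
  by rewrite mulmxDr -scalemxAr linearP.
exists (tens_lift bil).
exists (fun w => \sum_i \sum_j (vec_mx w i j) *: pure (delta_mx 0 i) (delta_mx 0 j)).
  elim/tens_ind => [u v|x y IHx IHy].
    rewrite tens_lift_pure mxvecK {2}(row_sum_delta u) pure_suml.
    apply: eq_bigr => i _; rewrite {2}(row_sum_delta v) pure_sumr.
    apply: eq_bigr => j _; rewrite pureZl pureZr scalerA; congr (_ *: _).
    by rewrite !mxE big_ord1 !mxE.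
  rewrite linearD -{2}IHx -{2}IHy -big_split; apply: eq_bigr => i _.
  by rewrite -big_split; apply: eq_bigr => j _; rewrite linearD mxE scalerDl.
move=> w; rewrite -[RHS]vec_mxK {2}(matrix_sum_delta (vec_mx w)) !linear_sum.
apply: eq_bigr => i _; rewrite !linear_sum; apply: eq_bigr => j _.
rewrite (linearZ_LR (tens_lift bil)) tens_lift_pure (linearZ_LR mxvec) trmx_delta.
by rewrite mul_delta_mx.
Qed.

Lemma azumaya_iso A B : alg_iso A B -> azumaya A -> azumaya B.
Proof.
move=> [f [[f1 fM] bf]] [ffgpA env_bij]; split.
  by apply: ffgp_iso ffgpA; exists f.
have [g [fK gK]] := hom_inv_ex bf.
have gM : {morph g : x y / amul x y}.
  by move=> x y; apply: (can_inj fK); rewrite fM !gK.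
pose cj (u : hom A A) : hom B B := hom_comp f (hom_comp u g).
have cj_bij : bijective cj.
  exists (fun u : hom B B => hom_comp g (hom_comp u f)) => u; apply: hom_ext => x /=.
    by rewrite !fK.
  by rewrite !gK.
have gg_bij : bijective (tmap g g) by apply: tmap_bij; exists f.
apply: (eq_bij (bij_comp cj_bij (bij_comp env_bij gg_bij))).
elim/tens_ind => [a b|x y IHx IHy].
  apply: hom_ext => x; rewrite env_mapE.
  rewrite -[LHS]/(f (env_map A (tmap g g (pure a b)) (g x))) tmapE env_mapE.
  by rewrite !fM !gK.
rewrite [RHS]linearD -IHx -IHy; apply: hom_ext => z.
rewrite -[LHS]/(f (env_map A (tmap g g (x + y)) (g z))).
by rewrite (linearD (tmap g g)) (linearD (env_map A)) homDE linearD.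
Qed.

Lemma azumaya_tens A B : azumaya A -> azumaya B -> azumaya (tens_alg A B).
Proof.
move=> [ffA eA] [ffB eB]; split; first exact: ffgp_tens.
have [/ffgpP[_ [I [x [f xf]]]] /ffgpP[_ [J [y [g yg]]]]] := (ffA, ffB).
have kb : bijective (tens_hom A A B B) by apply: tens_hom_bij xf yg.
apply: (eq_bij (bij_comp kb (bij_comp (tmap_bij eA eB) (tinter_bij A B A B)))).
elim/tens_ind4 => [a b a' b'|u v IHu IHv].
  rewrite -[LHS]/(tens_hom A A B B (tmap (env_map A) (env_map B)
    (tinter A B A B (pure (pure a b) (pure a' b'))))) tinterE tmapE tens_homE.
  apply: hom_ext; apply: tens_hom_ext => p q.
  by rewrite tmapE !env_mapE amul_tens amul_tens.
rewrite [RHS]linearD -IHu -IHv.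
rewrite -[LHS]/(tens_hom A A B B (tmap (env_map A) (env_map B)
  (tinter A B A B (u + v)))).
by rewrite !linearD.
Qed.

Lemma azumaya_end (P : lmodType R) : ffgp_mod P -> azumaya (end_alg P).
Proof.
move=> ffP; split; first exact: ffgp_hom.
have /ffgpP[_ [I [x [f xf]]]] := ffP.
pose psi (F : hom (hom P P) (hom P P)) : tens (hom P P) (hom P P) :=
  \sum_i \sum_j \sum_k
     pure (theta (f i) (F (theta (f j) (x i)) (x k))) (theta (f k) (x j)).
exists psi.
  elim/tens_ind => [u v|t t' IH IH'].
    rewrite {2}(theta_dual u xf) pure_suml; apply: eq_bigr => i _.
    rewrite exchange_big {2}(theta_dual v xf) pure_sumr; apply: eq_bigr => k _.
    rewrite {1}(xf (v (x k))) theta_sum pure_sumr; apply: eq_bigr => j _.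
    rewrite env_mapE !end_mulE !thetaE (linearZ_LR u) !thetaZ.
    by rewrite pureZl pureZr.
  rewrite linearD -{2}IH -{2}IH' /psi -big_split; apply: eq_bigr => i _.
  rewrite -big_split; apply: eq_bigr => j _.
  rewrite -big_split; apply: eq_bigr => k _.
  by rewrite !homDE thetaD pureDl.
move=> F; apply: hom_ext => w; apply: hom_ext => z.
have -> : F w z = \sum_i \sum_j (f i (w (x j)) : R) *: F (theta (f j) (x i)) z.
  rewrite exchange_big {1}(theta_dual w xf) linear_sum hom_sumE.
  apply: eq_bigr => j _; rewrite {1}(xf (w (x j))) theta_sum linear_sum hom_sumE.
  by apply: eq_bigr => i _; rewrite thetaZ (linearZ_LR F).
rewrite /psi linear_sum !hom_sumE; apply: eq_bigr => i _.
rewrite linear_sum !hom_sumE; apply: eq_bigr => j _.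
rewrite linear_sum !hom_sumE {2}(xf z) linear_sum scaler_sumr.
apply: eq_bigr => k _.
rewrite env_mapE !end_mulE !thetaE (linearZ_LR w) (linearZ_LR (f i)).
rewrite (linearZ_LR (F _)) !scalerA; congr (_ *: _).
exact: mulrC.
Qed.

End Algebras.

Section Classes.
Variables (T : Type) (e : T -> T -> Prop).

Definition classes : Type := {C : T -> Prop | exists x, C = e x}.
Definition cls (x : T) : classes := exist _ (e x) (ex_intro _ x erefl).
Definition cls_repr (c : classes) : T := projT1 (cid (proj2_sig c)).

Lemma cls_reprK c : cls (cls_repr c) = c.
Proof.
case: c => C C_cls; apply: eq_exist; rewrite /cls_repr /=.
by case: cid => x /= ->.
Qed.

Hypotheses (e_refl : forall x, e x x) (e_sym : forall x y, e x y -> e y x)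
  (e_trans : forall x y z, e x y -> e y z -> e x z).

Lemma clsP x y : cls x = cls y <-> e x y.
Proof.
split=> [[exy]|xy]; first by rewrite exy; apply: e_refl.
apply: eq_exist; apply/funext => z; apply/propext; split=> [xz|yz].
  exact: e_trans (e_sym xy) xz.
exact: e_trans xy yz.
Qed.

Lemma cls_repr_rel x : e (cls_repr (cls x)) x.
Proof. by apply/clsP; rewrite cls_reprK. Qed.

End Classes.

Record comMonoid := ComMonoid {
  cm_sort :> Type;
  cm_mul : cm_sort -> cm_sort -> cm_sort;
  cm_one : cm_sort;
  cm_mulA : associative cm_mul;
  cm_mulC : commutative cm_mul;
  cm_mul1 : left_id cm_one cm_mul
}.
Arguments cm_mul {c}.
Arguments cm_one {c}.

Record submonoid (M : comMonoid) := Submonoid {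
  sm_mem :> M -> Prop;
  sm_one : sm_mem cm_one;
  sm_mul : forall x y, sm_mem x -> sm_mem y -> sm_mem (cm_mul x y)
}.

Definition monoid_iso (M M' : comMonoid) (f : M -> M') : Prop :=
  [/\ f cm_one = cm_one, {morph f : x y / cm_mul x y} & bijective f].

Section QuotientMonoid.
Variables (M : comMonoid) (N : submonoid M).

Definition quo_rel (m1 m2 : M) : Prop :=
  exists n1 n2, [/\ N n1, N n2 & cm_mul m1 n1 = cm_mul m2 n2].

Lemma quo_refl m : quo_rel m m.
Proof. by exists cm_one, cm_one; split=> //; apply: sm_one. Qed.
Lemma quo_sym m1 m2 : quo_rel m1 m2 -> quo_rel m2 m1.
Proof. by move=> [n1 [n2 [N1 N2 eq]]]; exists n2, n1. Qed.
Lemma quo_trans m1 m2 m3 : quo_rel m1 m2 -> quo_rel m2 m3 -> quo_rel m1 m3.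
Proof.
move=> [n1 [n2 [N1 N2 eq12]]] [p2 [p3 [P2 P3 eq23]]].
exists (cm_mul n1 p2), (cm_mul p3 n2); split; try exact: sm_mul.
by rewrite cm_mulA eq12 -cm_mulA (cm_mulC n2) !cm_mulA eq23.
Qed.

Definition quo_sort : Type := classes quo_rel.
Definition quo_cls : M -> quo_sort := cls quo_rel.

Lemma quo_clsP m1 m2 : quo_cls m1 = quo_cls m2 <-> quo_rel m1 m2.
Proof. exact: (clsP quo_refl quo_sym quo_trans). Qed.

Lemma quo_rel_mul m1 m1' m2 m2' :
  quo_rel m1 m1' -> quo_rel m2 m2' -> quo_rel (cm_mul m1 m2) (cm_mul m1' m2').
Proof.
have AC (a b c d : M) : cm_mul (cm_mul a b) (cm_mul c d) = cm_mul (cm_mul a c) (cm_mul b d).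
  by rewrite !cm_mulA -(cm_mulA a) (cm_mulC b) cm_mulA.
move=> [n1 [n1' [N1 N1' eq1]]] [n2 [n2' [N2 N2' eq2]]].
exists (cm_mul n1 n2), (cm_mul n1' n2'); split; try exact: sm_mul.
by rewrite AC eq1 eq2 AC.
Qed.

Definition quo_mul (c d : quo_sort) : quo_sort :=
  quo_cls (cm_mul (cls_repr c) (cls_repr d)).
Lemma quo_mulE m1 m2 : quo_mul (quo_cls m1) (quo_cls m2) = quo_cls (cm_mul m1 m2).
Proof.
apply/quo_clsP; apply: quo_rel_mul; exact: (cls_repr_rel quo_refl quo_sym quo_trans).
Qed.

Lemma quo_reprK c : quo_cls (cls_repr c) = c. Proof. exact: cls_reprK. Qed.

Fact quo_mulA : associative quo_mul.
Proof.
by move=> c d f; rewrite -[c]quo_reprK -[d]quo_reprK -[f]quo_reprK !quo_mulE cm_mulA.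
Qed.
Fact quo_mulC : commutative quo_mul.
Proof. by move=> c d; rewrite /quo_mul cm_mulC. Qed.
Fact quo_mul1 : left_id (quo_cls cm_one) quo_mul.
Proof. by move=> c; rewrite -[c]quo_reprK quo_mulE cm_mul1. Qed.

Definition quo_monoid : comMonoid := ComMonoid quo_mulA quo_mulC quo_mul1.

End QuotientMonoid.

(* The natural map M/N -> M/N', for N included in N'.  It is given on a chosen
   representative, but quo_mapE shows that this choice is irrelevant. *)
Definition quo_map (M : comMonoid) (N N' : submonoid M)
    (sNN' : forall m, N m -> N' m) : quo_monoid N -> quo_monoid N' :=
  fun c => quo_cls N' (cls_repr c).

Lemma quo_mapE (M : comMonoid) (N N' : submonoid M)
    (sNN' : forall m, N m -> N' m) m :
  quo_map sNN' (quo_cls N m) = quo_cls N' m.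
Proof.
apply/quo_clsP.
have [n1 [n2 [N1 N2 eq]]] :=
  cls_repr_rel (@quo_refl M N) (@quo_sym M N) (@quo_trans M N) m.
by exists n1, n2; split=> //; apply: sNN'.
Qed.

Section BrauerMonoids.
Variable R : comPzRingType.

Definition azumaya_algebra : Type := {A : algebra R | azumaya A}.
Definition azu_iso (A B : azumaya_algebra) : Prop := alg_iso (sval A) (sval B).

Definition MA_sort : Type := classes azu_iso.
Definition MA_class (A : algebra R) (azA : azumaya A) : MA_sort :=
  cls azu_iso (exist _ A azA).

Let iso_refl (A : azumaya_algebra) : azu_iso A A.
Proof. exact: alg_iso_refl. Qed.
Let iso_sym (A B : azumaya_algebra) : azu_iso A B -> azu_iso B A.
Proof. exact: alg_iso_sym. Qed.
Let iso_trans (A B C : azumaya_algebra) :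
  azu_iso A B -> azu_iso B C -> azu_iso A C.
Proof. exact: alg_iso_trans. Qed.

Lemma MA_classP (A B : algebra R) (azA : azumaya A) (azB : azumaya B) :
  MA_class azA = MA_class azB <-> alg_iso A B.
Proof. exact: (clsP iso_refl iso_sym iso_trans). Qed.

Lemma MA_classE (c : MA_sort) : exists A (azA : azumaya A), c = MA_class azA.
Proof.
rewrite -(cls_reprK c); case: (cls_repr c) => A azA; by exists A, azA.
Qed.

Lemma alg_iso_base_mx : alg_iso (base_alg R) (mx_alg R 1).
Proof.
have lin_f : linear (fun a : R^o => a%:M : 'M[R]_1).
  by move=> a u v; rewrite raddfD /= scale_scalar_mx.
exists (mkhom lin_f : hom (base_alg R) (mx_alg R 1)); split.
  by split=> // a b /=; rewrite -scalar_mxM.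
exists (fun a : 'M[R]_1 => a 0 0 : R^o) => [a|a] /=; first by rewrite mxE.
by rewrite -mx11_scalar.
Qed.

Lemma azumaya_mx n : (0 < n)%N -> azumaya (mx_alg R n).
Proof.
move=> n_gt0; apply: azumaya_iso (alg_iso_sym (alg_iso_mx_end R n)) _.
exact/azumaya_end/ffgp_rV.
Qed.

Lemma azumaya_base : azumaya (base_alg R).
Proof. exact: azumaya_iso (alg_iso_sym alg_iso_base_mx) (azumaya_mx _). Qed.

Lemma alg_iso_mx_tens n m : (0 < n)%N -> (0 < m)%N ->
  alg_iso (tens_alg (mx_alg R n) (mx_alg R m)) (mx_alg R (n * m)).
Proof.
move=> n_gt0 m_gt0.
apply: alg_iso_trans (alg_iso_tens (alg_iso_mx_end R n) (alg_iso_mx_end R m)) _.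
apply: alg_iso_trans (alg_iso_end_tens (ffgp_rV R n_gt0) (ffgp_rV R m_gt0)) _.
apply: alg_iso_trans (alg_iso_end (rV_tens R n m)) _.
exact: alg_iso_sym (alg_iso_mx_end R _).
Qed.

Definition MA_mul (c d : MA_sort) : MA_sort :=
  MA_class (azumaya_tens (svalP (cls_repr c)) (svalP (cls_repr d))).

Lemma MA_mulE (A B : algebra R) (azA : azumaya A) (azB : azumaya B) :
  MA_mul (MA_class azA) (MA_class azB) = MA_class (azumaya_tens azA azB).
Proof.
apply/MA_classP; apply: alg_iso_tens.
  exact: (cls_repr_rel iso_refl iso_sym iso_trans (exist _ A azA)).
exact: (cls_repr_rel iso_refl iso_sym iso_trans (exist _ B azB)).
Qed.

Fact MA_mulA : associative MA_mul.
Proof.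
move=> c d e; have [A [azA ->]] := MA_classE c.
have [B [azB ->]] := MA_classE d; have [C [azC ->]] := MA_classE e.
by rewrite !MA_mulE; apply/MA_classP/alg_iso_sym/alg_iso_tensA.
Qed.
Fact MA_mulC : commutative MA_mul.
Proof.
move=> c d; have [A [azA ->]] := MA_classE c; have [B [azB ->]] := MA_classE d.
by rewrite !MA_mulE; apply/MA_classP/alg_iso_tensC.
Qed.
Fact MA_mul1 : left_id (MA_class azumaya_base) MA_mul.
Proof.
move=> c; have [A [azA ->]] := MA_classE c.
by rewrite MA_mulE; apply/MA_classP/alg_iso_tens1.
Qed.
Definition MA : comMonoid := ComMonoid MA_mulA MA_mulC MA_mul1.

Definition ME_mem (c : MA) : Prop :=
  exists (P : lmodType R) (ffgpP : ffgp_mod P), c = MA_class (azumaya_end ffgpP).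
Definition MM_mem (c : MA) : Prop :=
  exists (n : nat) (n_gt0 : (0 < n)%N), c = MA_class (azumaya_mx n_gt0).

Fact MM_one : MM_mem cm_one.
Proof. by exists 1%N, isT; apply/MA_classP/alg_iso_base_mx. Qed.
Fact MM_mul c d : MM_mem c -> MM_mem d -> MM_mem (cm_mul c d).
Proof.
move=> [n [n_gt0 ->]] [m [m_gt0 ->]].
have nm_gt0 : (0 < n * m)%N by rewrite muln_gt0 n_gt0.
exists (n * m)%N, nm_gt0; rewrite /= MA_mulE; exact/MA_classP/alg_iso_mx_tens.
Qed.
Definition MM : submonoid MA := Submonoid MM_one MM_mul.

Lemma sub_MM_ME c : MM_mem c -> ME_mem c.
Proof.
move=> [n [n_gt0 ->]]; exists 'rV[R]_n, (ffgp_rV R n_gt0).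
exact/MA_classP/alg_iso_mx_end.
Qed.

Fact ME_one : ME_mem cm_one.
Proof. exact/sub_MM_ME/MM_one. Qed.
Fact ME_mul c d : ME_mem c -> ME_mem d -> ME_mem (cm_mul c d).
Proof.
move=> [P [ffP ->]] [Q [ffQ ->]]; exists (tens P Q), (ffgp_tens ffP ffQ).
by rewrite /= MA_mulE; apply/MA_classP/alg_iso_end_tens.
Qed.
Definition ME : submonoid MA := Submonoid ME_one ME_mul.

Definition Br_star : comMonoid := quo_monoid MM.
Definition Br : comMonoid := quo_monoid ME.
Definition Br_star_to_Br : Br_star -> Br := @quo_map MA MM ME sub_MM_ME.

Lemma Br_star_to_BrE (c : MA) : Br_star_to_Br (quo_cls MM c) = quo_cls ME c.
Proof. exact: (@quo_mapE MA MM ME sub_MM_ME). Qed.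

End BrauerMonoids.

(* Main.v *)
Require Import Defs.
From mathcomp Require Import all_boot all_algebra.
From mathcomp Require Import boolp.
(* Restores [hom], which [all_algebra] shadows by that of vector.v. *)
Import Defs.

Set Implicit Arguments.
Unset Strict Implicit.
Unset Printing Implicit Defensive.

Import GRing.Theory.
Local Open Scope ring_scope.

(** For submonoids N of N' of a commutative monoid M, the map M/N -> M/N' is
    always a surjective morphism, and it is injective exactly when every n' in
    N' becomes trivial in M/N, that is, n' n lies in N for some n in N: then a
    relation m1 n1' = m2 n2' over N' can be multiplied into one over N. For N = MM(R) and
    N' = ME(R) this says that the algebras End(P) are stably matrix algebras.
    If P (x) R^n is isomorphic to R^m, then
    End(P) (x) M_n(R) = End(P (x) R^n) = M_m(R). *)

Section QuotientMap.
Variables (M : comMonoid) (N N' : submonoid M).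
Hypothesis sNN' : forall m, N m -> N' m.

Lemma quo_map_one : quo_map sNN' cm_one = cm_one.
Proof. exact: quo_mapE. Qed.

Lemma quo_mapM : {morph quo_map sNN' : c d / cm_mul c d}.
Proof.
move=> c d; rewrite -[c]quo_reprK -[d]quo_reprK /= quo_mulE !quo_mapE.
by rewrite quo_mulE.
Qed.

Lemma quo_map_isoP : monoid_iso (quo_map sNN') <->
  (forall n', N' n' -> exists n, N n /\ N (cm_mul n' n)).
Proof.
split=> [[_ _ /bij_inj inj_q] n' N'n'|kill].
  have : quo_cls N n' = quo_cls N cm_one.
    apply: inj_q; rewrite !quo_mapE; apply/quo_clsP.
    (* The relation n' 1 = 1 n' has both multipliers in [N'], so [n'] and 1 have the same image
       under the map. *)
    exists cm_one, n'; split=> //; first exact: sm_one.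
    by rewrite cm_mulC.
  move=> /quo_clsP[n1 [n2 [N1 N2]]]; rewrite cm_mul1 => eq12.
  by exists n1; rewrite eq12.
split; [exact: quo_map_one | exact: quo_mapM |].
exists (fun c => quo_cls N (cls_repr c)) => c; last by rewrite quo_mapE quo_reprK.
rewrite -[RHS]quo_reprK; apply/quo_clsP.
have /quo_clsP[n1 [n2 [N'1 N'2 eq12]]] :
    quo_cls N' (cls_repr (quo_map sNN' c)) = quo_cls N' (cls_repr c).
  by rewrite quo_reprK.
have [[k1 [Nk1 Nn1]] [k2 [Nk2 Nn2]]] := (kill _ N'1, kill _ N'2).
(* Both sides of [eq12] are multiplied by k1 k2: [k1] brings [n1] into [N] and [k2] brings [n2] into
   [N], while the spare factor already lies in [N]. *)
exists (cm_mul (cm_mul n1 k1) k2), (cm_mul (cm_mul n2 k2) k1).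
split; try exact: sm_mul.
by rewrite -!cm_mulA (cm_mulC k2) !cm_mulA eq12.
Qed.

End QuotientMap.

Section StablyMatrix.
Variable R : comPzRingType.
Implicit Types P Q : lmodType R.

Lemma mod_iso_sym P Q : mod_iso P Q -> mod_iso Q P.
Proof. by move=> [f /hom_inv_ex[g [fK gK]]]; exists g; exists f. Qed.

Lemma mod_iso_trans P Q (L : lmodType R) :
  mod_iso P Q -> mod_iso Q L -> mod_iso P L.
Proof. by move=> [f bf] [g bg]; exists (hom_comp g f); apply: bij_comp. Qed.

Lemma mod_iso_tensl P Q (L : lmodType R) :
  mod_iso P Q -> mod_iso (tens P L) (tens Q L).
Proof.
by move=> [f bf]; exists (tmap f (hom_id L)); apply: tmap_bij => //; exists id.
Qed.

(** Every module over the zero ring vanishes. This serves the degenerate case of rank 0 in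
    [free_ffgp_iso_rV]. *)
Lemma mod_iso_trivial P Q : 1 = 0 :> R -> mod_iso P Q.
Proof.
move=> R0; have triv (L : lmodType R) (x : L) : x = 0.
  by rewrite -[x]scale1r R0 scale0r.
by exists (0 : hom P Q), (fun=> 0) => x; rewrite [LHS]triv [RHS]triv.
Qed.

Definition lincomb P (s : seq P) (v : 'rV[R]_(size s)) : P :=
  \sum_i v 0 i *: s`_i.

Fact lincomb_lin P (s : seq P) : linear (@lincomb P s).
Proof.
move=> a u v; rewrite /lincomb scaler_sumr -big_split; apply: eq_bigr => i _ /=.
by rewrite !mxE scalerDl scalerA.
Qed.

Definition lincomb_hom P (s : seq P) : hom 'rV[R]_(size s) P :=
  mkhom (@lincomb_lin P s).

Lemma lincomb_inj P (B : P -> Prop) (s : seq P) : basis_mod B -> uniq s ->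
  (forall x, x \in s -> B x) -> injective (lincomb_hom s).
Proof.
move=> [indep _] Us sB u v /eqP; rewrite -subr_eq0 -linearB => /eqP w0.
apply/eqP; rewrite -subr_eq0; apply/eqP; move: (u - v) w0 => w w0.
(* Independence in [basis_mod] takes coefficients indexed by vectors, whereas [w] is indexed by
   positions. As [s] has no repetition, [index] translates between the two; the default 0 only
   occurs outside [s]. *)
pose c x := if insub (index x s) is Some i then w 0 i else 0.
have cE (i : 'I_(size s)) : c s`_i = w 0 i.
  by rewrite /c index_uniq // valK.
have c0 : \sum_(x <- s) c x *: x = 0.
  rewrite (big_nth 0) big_mkord -[RHS]w0; apply: eq_bigr => i _.
  by rewrite cE.
apply/rowP => i; rewrite mxE -cE.
by apply: (indep _ c Us sB c0); apply: mem_nth.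
Qed.

Lemma lincomb_mem P (s : seq P) x : x \in s -> exists v, lincomb_hom s v = x.
Proof.
rewrite -index_mem => ltxs; exists (delta_mx 0 (Ordinal ltxs)).
rewrite /= /lincomb (bigD1 (Ordinal ltxs)) //= mxE !eqxx scale1r.
rewrite nth_index ?big1 ?addr0 -?index_mem // => i /negPf ni.
by rewrite mxE ni andbF scale0r.
Qed.

Lemma lincomb_sum P (s : seq P) (I : Type) (r : seq I) (c : I -> R) (x : I -> P) :
  (forall i, exists v, lincomb_hom s v = x i) ->
  exists v, lincomb_hom s v = \sum_(i <- r) c i *: x i.
Proof.
move=> /choice[v vx]; exists (\sum_(i <- r) c i *: v i).
by rewrite linear_sum; apply: eq_bigr => i _; rewrite linearZ_LR vx.
Qed.

(** Each of the finitely many generators involves finitely many basis elements. Collected in [t],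
    these span [P], and they stay independent as part of a basis. *)
Lemma free_fingen_iso_rV P : free_mod P -> fingen_mod P ->
  exists m, mod_iso P 'rV[R]_m.
Proof.
move=> [B basB] [n [x gen_x]].
have /choice[s /choice[c sc]] := fun i => basB.2 (x i).
pose t := undup (flatten [seq s i | i <- enum 'I_n]).
have tE i y : y \in s i -> y \in t.
  by move=> ys; rewrite mem_undup; apply/flatten_mapP; exists i; rewrite ?mem_enum.
have tB y : y \in t -> B y.
  by rewrite mem_undup => /flatten_mapP[i _]; apply: (sc i).1.
have inj_t := lincomb_inj basB (undup_uniq _) tB.
exists (size t); apply: mod_iso_sym; exists (lincomb_hom t).
suff /choice[g gK] : forall z, exists v, lincomb_hom t v = z.
  by exists g => // v; apply: inj_t; rewrite gK.
move=> z; have [a ->] := gen_x z; apply: lincomb_sum => i.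
rewrite (sc i).2 big_seq big_mkcond.
(* [lincomb_sum] wants all its vectors in the span of [t], for every index of the type, so those
   outside [s i] are replaced by 0. *)
have -> : \sum_(y <- s i) (if y \in s i then c i y *: y else 0) =
    \sum_(y <- s i) (if y \in s i then c i y else 0) *: (if y \in s i then y else 0).
  by apply: eq_bigr => y _; case: ifP => // _; rewrite scaler0.
apply: lincomb_sum => y; case: ifP => [/tE/lincomb_mem //|_].
by exists 0; rewrite linear0.
Qed.

Lemma free_ffgp_iso_rV P : free_mod P -> ffgp_mod P ->
  exists2 m, (0 < m)%N & mod_iso P 'rV[R]_m.
Proof.
move=> freeP [ffP fgP _]; have [[|m] isoP] := free_fingen_iso_rV freeP fgP.
  (* In rank 0 the module is zero, so faithfulness forces 1 = 0 in [R], and rank 1 does as well. *)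
  exists 1%N => //; apply: mod_iso_trivial; apply: ffP => x.
  by have [f /bij_inj f_inj] := isoP; apply: f_inj; apply/rowP => -[].
by exists m.+1.
Qed.

Lemma free_stably_tensor_free P :
  ffgp_mod P -> free_mod P -> stably_tensor_free P.
Proof.
move=> ffgpP freeP; have [m m_gt0 isoP] := free_ffgp_iso_rV freeP ffgpP.
(* Tensoring with R^1 suffices; m * 1 is the rank in the form that [rV_tens] gives it. *)
exists 1%N, (m * 1)%N; split; rewrite ?muln_gt0 ?m_gt0 //.
exact: mod_iso_trans (mod_iso_tensl _ isoP) (rV_tens R m 1).
Qed.

Lemma stably_tensor_free_end P :
  ffgp_mod P -> stably_tensor_free P -> stably_matrix (end_alg P).
Proof.
move=> ffgpP [n [m [n_gt0 m_gt0 isoP]]]; exists n, m; split=> //.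
apply: alg_iso_trans (alg_iso_tens (alg_iso_refl _) (alg_iso_mx_end R n)) _.
apply: alg_iso_trans (alg_iso_end_tens ffgpP (ffgp_rV R n_gt0)) _.
exact: alg_iso_trans (alg_iso_end isoP) (alg_iso_sym (alg_iso_mx_end R m)).
Qed.

(** This turns the criterion of [quo_map_isoP], for the submonoid [MM], into a property of algebras:
    the multiplier [c] is the class of the matrix algebra tensored with [A]. *)
Lemma stably_matrix_MM (A : algebra R) (azA : azumaya A) :
  stably_matrix A <->
  exists c, MM R c /\ MM R (cm_mul (MA_class azA : MA R) c).
Proof.
split=> [[n [m [n_gt0 m_gt0 isoA]]]|[_ [[n [n_gt0 ->]] [m [m_gt0]]]]].
  exists (MA_class (azumaya_mx R n_gt0)); split; first by exists n, n_gt0.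
  by exists m, m_gt0; rewrite /= MA_mulE; apply/MA_classP.
by rewrite /= MA_mulE => /MA_classP isoA; exists n, m.
Qed.

End StablyMatrix.

Theorem corollary5 (R : comPzRingType) :
  (monoid_iso (@Br_star_to_Br R) <->
     (forall P : lmodType R, ffgp_mod P -> stably_matrix (end_alg P)))
  /\ ((forall P : lmodType R, ffgp_mod P -> free_mod P) ->
        forall P : lmodType R, ffgp_mod P -> stably_matrix (end_alg P))
  /\ ((forall P : lmodType R, ffgp_mod P -> stably_tensor_free P) ->
        forall P : lmodType R, ffgp_mod P -> stably_matrix (end_alg P)).
Proof.
split; last split=> freeP P ffgpP.
- split=> [/quo_map_isoP kill P ffgpP|stab].
    by apply/(stably_matrix_MM (azumaya_end ffgpP))/kill; exists P, ffgpP.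
  apply/quo_map_isoP => _ [P [ffgpP ->]].
  exact/stably_matrix_MM/stab.
- by apply: stably_tensor_free_end => //; apply/free_stably_tensor_free/freeP.
- by apply: stably_tensor_free_end => //; apply: freeP.
Qed.
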